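(* Let $n\ge 1$. There is a one to one correspondence (bijection) between the set of idempotent functions $f:\{1,\dots,n\}\to\{1,\dots,n\}$ (functions with $f\circ f=f$) and the set of complete exceptional sequences of $\Lambda_n$-modules, where $\Lambda_n$ is the linear radical square zero Nakayama algebra of rank $n$.
   Context: Let $k$ be an algebraically closed field and let $\Lambda_n=kQ/\mathrm{rad}^2(kQ)$ where $Q$ is the linearly oriented quiver $1\to 2\to\cdots\to n$; finite-dimensional $\Lambda_n$-modules are identified with finite-dimensional representations of $Q$ in which the composition of any two consecutive arrows is zero. This $\Lambda_n$ is the linear radical square zero Nakayama algebra of rank $n$. A $\Lambda_n$-module $M$ is exceptional if it is indecomposable, $\mathrm{Hom}(M,M)\cong k$ and $\mathrm{Ext}^i(M,M)=0$ for all $i\ge 1$. A pair $(M,N)$ of exceptional modules is an exceptional pair if $\mathrm{Hom}(N,M)=0$ and $\mathrm{Ext}^i(N,M)=0$ for all $i\ge 1$. A sequence $(M_1,\dots,M_t)$ of exceptional $\Lambda_n$-modules is an exceptional sequence if $(M_i,M_j)$ is an exceptional pair for all $1\le i<j\le t$; it is complete if $t=n$. The entries of exceptional sequences are isomorphism classes of modules. *)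

(* Defs.v *)
From HB Require Import structures.
From mathcomp Require Import all_boot all_order all_algebra.
From mathcomp Require Import boolp classical_sets functions.

Set Implicit Arguments.
Unset Strict Implicit.
Unset Printing Implicit Defensive.

Import GRing.Theory.
Local Open Scope classical_set_scope.
Local Open Scope ring_scope.

(* The vertices 1, ..., n of the quiver 1 -> 2 -> ... -> n are numbered
   0, ..., n.-1 here. *)
Definition arrow n (i j : 'I_n) : bool := (j == i.+1 :> nat).

(* A finite-dimensional module over kQ / rad^2(kQ), as a representation of Q
   in which consecutive arrows compose to zero.  The space at vertex i is
   'rV[k]_(dim i), and linear maps are matrices acting on row vectors from the
   right, so that A *m B is "A, then B".  Taking coordinate spaces loses no
   isomorphism class and keeps the type of representations small enough for
   [set] and [tuple], which a family of abstract vectTypes is not. *)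
Record rep (k : fieldType) (n : nat) := Rep {
  dim :> 'I_n -> nat;
  act : forall i j : 'I_n, arrow i j -> 'M[k]_(dim i, dim j);
  act_rad2 : forall (i j l : 'I_n) (a : arrow i j) (b : arrow j l),
    act a *m act b = 0 }.

Record hom (k : fieldType) (n : nat) (M N : rep k n) := HomRep {
  hom_fun :> forall i, 'M[k]_(M i, N i);
  hom_comm : forall (i j : 'I_n) (a : arrow i j),
    act M a *m hom_fun j = hom_fun i *m act N a }.

Section HomSpace.
Variables (k : fieldType) (n : nat).
Implicit Types L M N : rep k n.

Lemma homP M N (f g : hom M N) : (forall i, f i = g i) -> f = g.
Proof.
case: f g => [f cf] [g cg] /= fg.
have E : f = g by apply: functional_extensionality_dep.
by case: g / E cg {fg} => cg; congr HomRep; apply: Prop_irrelevance.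
Qed.

Fact hom_id_comm M (i j : 'I_n) (a : arrow i j) :
  act M a *m 1%:M = 1%:M *m act M a.
Proof. by rewrite mulmx1 mul1mx. Qed.
Definition hom_id M : hom M M := HomRep (@hom_id_comm M).

Fact hom_comp_comm L M N (g : hom M N) (f : hom L M) (i j : 'I_n)
    (a : arrow i j) :
  act L a *m (f j *m g j) = (f i *m g i) *m act N a.
Proof. by rewrite mulmxA hom_comm -!mulmxA hom_comm. Qed.
Definition hom_comp L M N (g : hom M N) (f : hom L M) : hom L N :=
  HomRep (@hom_comp_comm L M N g f).

Variables M N : rep k n.

HB.instance Definition _ := gen_eqMixin (hom M N).
HB.instance Definition _ := gen_choiceMixin (hom M N).

Fact hom_zero_comm (i j : 'I_n) (a : arrow i j) :
  act M a *m (0 : 'M_(M j, N j)) = (0 : 'M_(M i, N i)) *m act N a.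
Proof. by rewrite mulmx0 mul0mx. Qed.
Definition hom_zero : hom M N := HomRep hom_zero_comm.

Fact hom_opp_comm (f : hom M N) (i j : 'I_n) (a : arrow i j) :
  act M a *m (- f j) = (- f i) *m act N a.
Proof. by rewrite mulmxN mulNmx hom_comm. Qed.
Definition hom_opp f : hom M N := HomRep (@hom_opp_comm f).

Fact hom_add_comm (f g : hom M N) (i j : 'I_n) (a : arrow i j) :
  act M a *m (f j + g j) = (f i + g i) *m act N a.
Proof. by rewrite mulmxDr mulmxDl !hom_comm. Qed.
Definition hom_add f g : hom M N := HomRep (@hom_add_comm f g).

Fact hom_scale_comm (c : k) (f : hom M N) (i j : 'I_n) (a : arrow i j) :
  act M a *m (c *: f j) = (c *: f i) *m act N a.
Proof. by rewrite -scalemxAr -scalemxAl hom_comm. Qed.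
Definition hom_scale c f : hom M N := HomRep (@hom_scale_comm c f).

Fact hom_addA : associative hom_add.
Proof. by move=> f g h; apply: homP => i /=; rewrite addrA. Qed.
Fact hom_addC : commutative hom_add.
Proof. by move=> f g; apply: homP => i /=; rewrite addrC. Qed.
Fact hom_add0 : left_id hom_zero hom_add.
Proof. by move=> f; apply: homP => i /=; rewrite add0r. Qed.
Fact hom_addN : left_inverse hom_zero hom_opp hom_add.
Proof. by move=> f; apply: homP => i /=; rewrite addNr. Qed.

HB.instance Definition _ :=
  GRing.isZmodule.Build (hom M N) hom_addA hom_addC hom_add0 hom_addN.

Fact hom_scaleA (a b : k) (f : hom M N) :
  hom_scale a (hom_scale b f) = hom_scale (a * b) f.
Proof. by apply: homP => i /=; rewrite scalerA. Qed.
Fact hom_scale1 : left_id 1 hom_scale.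
Proof. by move=> f; apply: homP => i /=; rewrite scale1r. Qed.
Fact hom_scaleDr : right_distributive hom_scale +%R.
Proof. by move=> c f g; apply: homP => i /=; rewrite scalerDr. Qed.
Fact hom_scaleDl (f : hom M N) : {morph hom_scale^~ f : a b / a + b}.
Proof. by move=> a b; apply: homP => i /=; rewrite scalerDl. Qed.

HB.instance Definition _ := GRing.Zmodule_isLmodule.Build k (hom M N)
  hom_scaleA hom_scale1 hom_scaleDr hom_scaleDl.

End HomSpace.

Section DirectSum.
Variables (k : fieldType) (n : nat) (M N : rep k n).

Definition sum_act (i j : 'I_n) (a : arrow i j) :
    'M[k]_(M i + N i, M j + N j) :=
  block_mx (act M a) 0 0 (act N a).

Fact sum_rad2 (i j l : 'I_n) (a : arrow i j) (b : arrow j l) :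
  sum_act a *m sum_act b = 0.
Proof.
by rewrite mulmx_block !act_rad2 !mulmx0 !mul0mx !addr0 block_mx0.
Qed.

Definition rep_sum : rep k n :=
  @Rep k n (fun i => M i + N i)%N sum_act sum_rad2.

End DirectSum.

Section Modules.
Variables (k : fieldType) (n : nat).
Implicit Types L M N P : rep k n.

Definition isomorphic M N : Prop :=
  exists (f : hom M N) (g : hom N M),
    hom_comp g f = hom_id M /\ hom_comp f g = hom_id N.

Definition isoclass M : set (rep k n) := [set N | isomorphic M N].

Definition zero_rep M : Prop := forall i, M i = 0%N.

Definition indecomposable M : Prop :=
  ~ zero_rep M /\
  forall A B : rep k n, isomorphic M (rep_sum A B) -> zero_rep A \/ zero_rep B.

Definition epi M N (f : hom M N) : Prop := forall i, row_full (f i).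

Definition exact_at L M N (f : hom L M) (g : hom M N) : Prop :=
  forall i, (f i == kermx (g i))%MS.

Definition projective P : Prop :=
  forall M N (p : hom M N) (f : hom P N), epi p ->
    exists g : hom P M, hom_comp p g = f.

(* ... -> P_1 -> P_0 -> M -> 0 *)
Record projective_resolution M := ProjectiveResolution {
  res_obj : nat -> rep k n;
  res_diff : forall i, hom (res_obj i.+1) (res_obj i);
  res_aug : hom (res_obj 0) M;
  res_proj : forall i, projective (res_obj i);
  res_epi : epi res_aug;
  res_exact0 : exact_at (res_diff 0) res_aug;
  res_exact : forall i, exact_at (res_diff i.+1) (res_diff i) }.

(* In the complex 0 -> Hom(P_0, N) -> Hom(P_1, N) -> ... *)
Definition cocycles M (P : projective_resolution M) N (i : nat) :
    set (hom (res_obj P i) N) :=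
  [set f | hom_comp f (res_diff P i) = 0].

Definition coboundaries M (P : projective_resolution M) N (i : nat) :
    set (hom (res_obj P i) N) :=
  match i with
  | 0 => [set 0]
  | j.+1 => [set hom_comp g (res_diff P j) | g in [set: hom (res_obj P j) N]]
  end.

(* Ext^i(M, N) = 0.  Every M has a projective resolution, and by the comparison
   theorem the choice of P is immaterial. *)
Definition Ext_zero (i : nat) M N : Prop :=
  exists P : projective_resolution M,
    @cocycles M P N i `<=` @coboundaries M P N i.

Definition exceptional M : Prop :=
  [/\ indecomposable M,
      exists phi : {linear k^o -> hom M M}, bijective phi
    & forall i, (1 <= i)%N -> Ext_zero i M M].

Definition exceptional_pair M N : Prop :=
  [/\ exceptional M, exceptional N,
      forall f : hom N M, f = 0
    & forall i, (1 <= i)%N -> Ext_zero i N M].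

Definition exceptional_sequence t (M : t.-tuple (rep k n)) : Prop :=
  (forall i : 'I_t, exceptional (tnth M i)) /\
  (forall i j : 'I_t, (i < j)%N -> exceptional_pair (tnth M i) (tnth M j)).

(* The entries are isomorphism classes of modules. *)
Definition complete_exceptional_sequences : set (n.-tuple (set (rep k n))) :=
  [set map_tuple isoclass M | M in [set M : n.-tuple (rep k n) |
                                    exceptional_sequence M]].

End Modules.

(* Main.v *)
(* The indecomposables are the simples S_a and, for a < n, the projectives P_a
   with top S_a and socle S_(a+1): a nonzero arrow of a representation whose
   endomorphisms are all scalars splits off a P_a.  View S_a as the vertex a
   and P_a as the edge {a, a+1} of a path.  The exceptional pairs are such
   that in a complete exceptional sequence each connected component of the
   chosen edges, an interval [l, r] of vertices, contains exactly one chosen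
   vertex c, its root; the members of this component occur in the order
   P_(r-1), ..., P_c, S_c, P_(c-1), ..., P_l; and the roots of the different
   components increase from left to right, with no other constraint.  Sending
   each position of the sequence to the position of the root of its component
   is the bijection onto idempotent functions: the fibres are the components,
   in the order of their fixed points. *)
Require Import Defs.
From HB Require Import structures.
From mathcomp Require Import all_boot all_order all_algebra zify.
From mathcomp Require Import boolp classical_sets functions.
(* Takes back the name [hom] from vector.v. *)
Import Defs.

Set Implicit Arguments.
Unset Strict Implicit.
Unset Printing Implicit Defensive.

Import GRing.Theory.

(* The letter (t, a) stands for the interval module with support [a, a + t]:
   S_a if t = false, P_a if t = true.  There is a nonzero homomorphism from
   the module of x to that of y iff [interval_hom x y]. *)
Definition interval_hom (x y : bool * nat) : bool :=
  [&& y.2 <= x.2, x.2 <= y.2 + y.1 & y.2 + y.1 <= x.2 + x.1].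

(** The second factor is the Ext condition: a positive Ext from the module of [y] to that of [x] is
    nonzero only for simples S_b, S_a with b < a, in degree a - b. *)
Definition compatible (x y : bool * nat) : bool :=
  ~~ interval_hom y x && [|| x.1, y.1 | x.2 <= y.2].

(** * Sorting positions into vertices *)

Section Ranks.
Variable n : nat.
Implicit Types (f v : 'I_n -> 'I_n).

(** Components follow the order of their roots, but inside a component vertices go down as positions
    go up; hence the reversed second comparison. *)
Definition lex_lt f (i j : 'I_n) : bool :=
  (f i < f j) || (f i == f j) && (j < i).

Definition lex_rank f (j : 'I_n) : nat := #|[set i | lex_lt f i j]|.

(* In the component of j, each non-root vertex is paired with the edge joining
   it to its neighbour on the side of the root; listing the vertices of the
   whole path in increasing order amounts to sorting positions by [lex_lt]. *)
Definition letter f (j : 'I_n) : bool * nat :=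
  (j != f j, lex_rank f j - (j < f j)).

Lemma lex_rank_lt f i j : lex_lt f i j -> lex_rank f i < lex_rank f j.
Proof.
move=> ij; apply/proper_card/properP; split.
  apply/fintype.subsetP => l; rewrite !inE /lex_lt -!val_eqE /= in ij *; lia.
by exists i; rewrite !inE // /lex_lt -!val_eqE /=; lia.
Qed.

Lemma lex_rank_ltn f j : lex_rank f j < n.
Proof.
rewrite -[X in _ < X]card_ord -cardsT; apply/proper_card/properP.
by split=> //; exists j; rewrite ?inE // /lex_lt; lia.
Qed.

Lemma lex_total f i j : [|| i == j, lex_lt f i j | lex_lt f j i].
Proof. by rewrite /lex_lt -!val_eqE /=; lia. Qed.

Lemma lex_rank_ltE f i j : (lex_rank f i < lex_rank f j) = lex_lt f i j.
Proof.
apply/idP/idP; last exact: lex_rank_lt.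
have /or3P[/eqP->|//|/lex_rank_lt] := lex_total f i j; lia.
Qed.

Lemma lex_rank_inj f : injective (lex_rank f).
Proof.
move=> i j ij; have /or3P[/eqP//|/lex_rank_lt|/lex_rank_lt] := lex_total f i j;
  lia.
Qed.

Lemma lex_rank_onto f e : e < n -> exists i, lex_rank f i = e.
Proof.
move=> en; pose r i := Ordinal (lex_rank_ltn f i).
have rinj : injective r by move=> i j /(congr1 val)/lex_rank_inj.
have [s _ sK] := injF_bij rinj.
by exists (s (Ordinal en)); rewrite -[LHS]/(val (r _)) sK.
Qed.

(** Being onto as well, [v] matches the predecessors of [j] with the numbers below [v j]. This
    identifies the vertices reconstructed from a word with ranks. *)
Lemma lex_rank_uniq f v : injective v ->
  (forall i j, (v i < v j) = lex_lt f i j) -> forall j, lex_rank f j = v j.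
Proof.
move=> vinj vlt j; rewrite /lex_rank.
have -> : [set i | lex_lt f i j] = v @^-1: [set l : 'I_n | l < v j]%SET.
  by apply/setP => i; rewrite !inE vlt.
rewrite on_card_preimset; last first.
  have [s sK Ks] := injF_bij vinj.
  by exists s => x _; [exact: sK | exact: Ks].
have -> : [set l : 'I_n | l < v j]%SET =
    [set widen_ord (ltnW (ltn_ord (v j))) l | l : 'I_(v j)]%SET.
  apply/setP => l; rewrite inE.
  apply/idP/imsetP => [lt|[x _ ->] /=]; last first.
    exact: ltn_ord.
  by exists (Ordinal lt) => //; apply: val_inj.
by rewrite card_imset ?card_ord // => x y /(congr1 val) /= xy; apply: val_inj.
Qed.

Definition edge (w : 'I_n -> bool * nat) e := exists i, w i = (true, e).

(** The vertices [u] and [c] lie in one component; edge [e] joins [e] and [e + 1]. *)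
Definition linked w (u c : nat) : Prop :=
  forall e, (u <= e < c) || (c <= e < u) -> edge w e.

(** * From idempotent functions to compatible words *)

Section Idempotent.
Variable f : 'I_n -> 'I_n.
Hypothesis ff : forall i, f (f i) = f i.
Let v := lex_rank f.
Let ltE i j : (v i < v j) = lex_lt f i j := lex_rank_ltE f i j.
Let vinj i j : v i = v j -> i = j := @lex_rank_inj f i j.

Lemma letter_range j : (letter f j).2 + (letter f j).1 < n.
Proof.
rewrite /letter /= -val_eqE /= -/(v j); have := ltE (f j) j.
have := ltE j (f j); have := lex_rank_ltn f (f j); have := lex_rank_ltn f j.
rewrite -/(v _) -/(v _) /lex_lt !ff -!val_eqE /=; lia.
Qed.

Lemma letter_cases j : [\/ letter f j = (false, v j) /\ f j = j :> nat,
   [/\ j < f j, letter f j = (true, (v j).-1) & v (f j) < v j] |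
   [/\ f j < j, letter f j = (true, v j) & v j < v (f j)]].
Proof.
rewrite /letter -/(v j) !ltE /lex_lt ff ltnn eqxx.
have [jf|jf|/val_inj jf] := ltngtP j (f j).
- by constructor 2; rewrite subn1 -val_eqE /= neq_ltn jf.
- by constructor 3; rewrite subn0 -val_eqE /= neq_ltn jf orbT.
- by constructor 1; rewrite -jf eqxx subn0.
Qed.

Lemma lex_rank_fibre_lt i j : f i < f j ->
  [/\ v i < v j, v i < v (f j), v (f i) < v j & v (f i) < v (f j)].
Proof. by move=> fij; rewrite !ltE /lex_lt !ff fij. Qed.

(** Different fibres occupy disjoint intervals of vertices, so no homomorphism joins them, and their
    simples are roots, in increasing order. Within a fibre, nonzero homomorphisms between distinct
    letters go to lower vertices, that is, to the right. *)
Lemma letter_compatible (i j : 'I_n) :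
  i < j -> compatible (letter f i) (letter f j).
Proof.
move=> ij; rewrite /compatible /interval_hom.
have [fij|fij|fij] := ltngtP (f i) (f j).
- have [v1 v2 v3 v4] := lex_rank_fibre_lt fij.
  case: (letter_cases i) => [[-> fi]|[fi -> vi]|[fi -> vi]];
    case: (letter_cases j) => [[-> fj]|[fj -> vj]|[fj -> vj]] /=; lia.
- have [v1 v2 v3 v4] := lex_rank_fibre_lt fij.
  case: (letter_cases i) => [[-> fi]|[fi -> vi]|[fi -> vi]];
    case: (letter_cases j) => [[-> fj]|[fj -> vj]|[fj -> vj]] /=; lia.
have vji : v j < v i by rewrite ltE /lex_lt (val_inj fij) ltnn eqxx.
have vf : v (f i) = v (f j) by rewrite (val_inj fij).
case: (letter_cases i) => [[-> fi]|[fi -> vi]|[fi -> vi]];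
  case: (letter_cases j) => [[-> fj]|[fj -> vj]|[fj -> vj]] /=; lia.
Qed.

(** This recovers [f] from its word: [f j] is the position of the simple letter in the component of
    letter [j], unique by compatibility. *)
Lemma letter_linked j :
  letter f (f j) = (false, v (f j)) /\
  linked (letter f) (letter f j).2 (v (f j)).
Proof.
split; first by rewrite /letter ff eqxx ltnn subn0.
move=> e; rewrite /letter /= -/(v j) => eP.
have := lex_rank_ltn f (f j); have := lex_rank_ltn f j.
rewrite -/(v _) -/(v _) => ltj ltfj.
(* Below the root, edge [e] belongs to its lower vertex [e]; above the root, to its upper vertex
   [e.+1]. *)
have [] := ltnP e (v (f j)) => ev.
  have [|i vi] := @lex_rank_onto f e; first by lia.
  exists i; move: (ltE j i) (ltE i j) (ltE i (f j)).
  move: (ltE i (f i)) (ltE (f j) j) (ltE j (f j)).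
  rewrite /letter -/(v i) /lex_lt !ff -!val_eqE /= in vi *.
  rewrite vi; move=> *; congr (_, _); lia.
have [|i vi] := @lex_rank_onto f e.+1; first by lia.
exists i; move: (ltE j i) (ltE i j) (ltE (f j) i).
move: (ltE i (f i)) (ltE (f j) j) (ltE j (f j)).
rewrite /letter -/(v i) /lex_lt !ff -!val_eqE /= in vi *.
rewrite vi; move=> *; congr (_, _); lia.
Qed.

End Idempotent.

(** * Uniqueness of roots in compatible words *)

Section CompatibleWords.
Variable w : 'I_n -> bool * nat.
Hypothesis wcompat : forall i j : 'I_n, i < j -> compatible (w i) (w j).

Lemma incompatible_ltn i j : i != j -> ~~ compatible (w i) (w j) -> j < i.
Proof.
move=> ij; apply: contraNT; rewrite -leqNgt => le; apply: wcompat.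
by move: ij; rewrite -val_eqE /=; lia.
Qed.

(** The identity is a nonzero homomorphism, so no letter is compatible with itself. *)
Lemma compatible_word_inj : injective w.
Proof.
move=> i j wij; apply/eqP/negPn/negP => ij.
have nc : ~~ compatible (w i) (w j).
  by rewrite wij /compatible /interval_hom; lia.
have := incompatible_ltn ij nc; rewrite eq_sym in ij.
rewrite wij -{2}wij in nc; have := incompatible_ltn ij nc; lia.
Qed.

(* Along a path of edges from vertex c up to vertex d, compatibility forces
   the letters of d, d-1, ..., c to appear from left to right, whereas the
   vertices c < d themselves must appear in increasing order. *)
Lemma linked_vertices_eq i j c d :
  w i = (false, c) -> w j = (false, d) -> linked w c d -> c = d.
Proof.
suff H i' j' c' d' : w i' = (false, c') -> w j' = (false, d') ->
    linked w c' d' -> ~ c' < d'.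
  move=> wi wj l; have := H _ _ _ _ wi wj l.
  have : ~ d < c by apply: H wj wi _ => e ed; apply: l; lia.
  lia.
move=> {i j c d}; move: i' j' c' d' => i j c d wi wj l cd.
have before e : c + e < d -> forall h, w h = (true, c + e) -> h < i.
  elim: e => [|e IH] lt h wh.
    apply: incompatible_ltn; last by
      rewrite wi wh /compatible /interval_hom /=; lia.
    by apply/eqP => E; move: wh; rewrite -E wi.
  have [|h' wh'] := l (c + e); first lia.
  have := IH _ _ wh'; suff : h < h' by lia.
  apply: incompatible_ltn; last by
    rewrite wh' wh /compatible /interval_hom /=; lia.
  by apply/eqP => E; move: wh; rewrite -E wh' => -[]; lia.
have [|h wh] := l d.-1; first lia.
have := before (d.-1 - c) _ h; rewrite subnKC; last lia.
move=> /(_ _ wh) hi.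
have jh : j < h.
  apply: incompatible_ltn; last by
    rewrite wj wh /compatible /interval_hom /=; lia.
  by apply/eqP => E; move: wh; rewrite E wj.
have : i < j.
  apply: incompatible_ltn; last by
    rewrite wi wj /compatible /interval_hom /=; lia.
  by apply/eqP => E; move: wj; rewrite E wi => -[]; lia.
lia.
Qed.

End CompatibleWords.

Lemma letter_inj f g : (forall i, f (f i) = f i) -> (forall i, g (g i) = g i) ->
  letter f =1 letter g -> f = g.
Proof.
move=> ff gg fg; apply/funext => j.
have fgE : letter g = letter f by apply/funext => i; rewrite fg.
have wc := letter_compatible ff.
have [wfj lf] := letter_linked ff j; have [wgj lg] := letter_linked gg j.
rewrite fgE in wgj lg.
apply: (compatible_word_inj wc); rewrite wfj wgj.
(* Both roots are linked to the lower end of letter [j], hence to each other. *)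
congr pair; apply: (linked_vertices_eq wc wfj wgj) => e eP.
case: (boolP (((letter f j).2 <= e < lex_rank f (f j)) ||
  (lex_rank f (f j) <= e < (letter f j).2))) => [/lf //|h].
case: (boolP (((letter f j).2 <= e < lex_rank g (g j)) ||
  (lex_rank g (g j) <= e < (letter f j).2))) => [/lg //|h'].
by lia.
Qed.

(** * From compatible words to idempotent functions *)

Section Surjectivity.
Variable w : 'I_n -> bool * nat.
Hypothesis wcompat : forall i j : 'I_n, i < j -> compatible (w i) (w j).
Hypothesis wrange : forall i, (w i).2 + (w i).1 < n.
Let winj := compatible_word_inj wcompat.
Let link_eq := linked_vertices_eq wcompat.

Definition left_rooted a : Prop :=
  exists i c, [/\ w i = (false, c), c <= a & linked w c a.+1].

(* The vertex of a letter: for an edge, its end farther from the root.  If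
   there is no root on the left then one is expected on the right; that it
   exists follows from injectivity of [top] by counting. *)
Definition top (x : bool * nat) : nat := x.2 + (x.1 && `[< left_rooted x.2 >]).

(** A clash between distinct letters has three forms. Edges [b], [b + 1] with only the first
    left-rooted: its root also serves the second. A left-rooted edge ending at a simple: two linked
    simples. An edge starting at a simple but not left-rooted: that simple is a left root. *)
Lemma top_inj : injective (top \o w).
Proof.
pose P i j := (w i).1 <= (w j).1 /\ ((w i).1 = (w j).1 -> (w i).2 <= (w j).2).
suff H i j : P i j -> top (w i) = top (w j) -> i = j.
  move=> i j /= E; have [ij|ij] : P i j \/ P j i by rewrite /P; lia.
    exact: H.
  by apply/esym/H.
rewrite /P /top => -[le1 le2] E.
case wiE: (w i) le1 le2 E => [u b]; case wjE: (w j) => [t a] /=.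
case: u wiE => wiE; case: t wjE => wjE //= _.
- move=> /(_ erefl) ba; case: asboolP => rb; case: asboolP => ra E.
  + by apply: winj; rewrite wiE wjE; congr pair; lia.
  + case: ra; have [r [c [wr cb lc]]] := rb; exists r, c; split=> //; first lia.
    move=> e eP; have [|] := ltnP e b.+1 => eb; first by apply: lc; lia.
    by exists j; rewrite wjE; congr pair; lia.
  + lia.
  + by apply: winj; rewrite wiE wjE; congr pair; lia.
- move=> _; case: asboolP => ra E.
  + have [r [c [wr cb lc]]] := ra.
    have := link_eq wr wiE; rewrite (_ : b = a.+1); last lia.
    by move=> /(_ lc); lia.
  + case: ra; exists i, b; split=> //; first lia.
    by move=> e eP; exists j; rewrite wjE; congr pair; lia.
- by move=> /(_ erefl) ba E; apply: winj; rewrite wiE wjE; congr pair; lia.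
Qed.

Lemma top_ltn j : top (w j) < n.
Proof. by have := wrange j; rewrite /top; lia. Qed.

Definition vertex j : 'I_n := Ordinal (top_ltn j).
Arguments vertex : simpl never.

Lemma vertex_inj : injective vertex.
Proof. by move=> i j /(congr1 val) /top_inj. Qed.

Lemma top_onto e : e < n -> exists j, top (w j) = e.
Proof.
move=> en; have [s _ sK] := injF_bij vertex_inj.
by exists (s (Ordinal en)); rewrite -[LHS]/(val (vertex _)) sK.
Qed.

(** If edge [a] has no root on its left, the letter with top [a + 1] is a simple, the root sought,
    or the edge [a + 1], again not left-rooted. The range bound stops this climb. *)
Lemma rootedP j : exists ic, [/\ w ic.1 = (false, ic.2),
   w j = (vertex j != ic.2 :> nat, vertex j - (ic.2 < vertex j)) &
   linked w (vertex j) ic.2].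
Proof.
case wjE : (w j) => [[] a]; last first.
  exists (j, a) => /=; rewrite wjE /top /= addn0; split=> //.
    by rewrite eqxx ltnn subn0.
  by move=> e; lia.
rewrite /= wjE /top /=; case: asboolP => [[i [c [wi ca l]]]|nl].
  exists (i, c) => /=; split=> //; first by congr pair; lia.
  by move=> e eP; apply: l; lia.
suff : exists i c, [/\ w i = (false, c), a < c & linked w a c].
  case=> i [c [wi ac l]]; exists (i, c) => /=; rewrite addn0; split=> //.
  by congr pair; lia.
have [m] := ubnP (n - a); elim: m a j wjE nl => // m IH a j wjE nl am.
have := wrange j; rewrite wjE /= addn1 => an.
have [j'] := top_onto an; rewrite /top.
case wj'E : (w j') => [[] b] /=; last first.
  rewrite addn0 => ba; exists j', a.+1; split=> //; first by rewrite wj'E ba.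
  by move=> e eP; exists j; rewrite wjE; congr pair; lia.
case: asboolP => rb ba.
  by case: nl; rewrite (_ : a = b) //; lia.
have [|i [c [wi cb l]]] := IH b j' wj'E rb; first by lia.
exists i, c; split=> //; first lia.
move=> e eP; have [|] := ltnP e b => eb; last by apply: l; lia.
by exists j; rewrite wjE; congr pair; lia.
Qed.

(** The function is [r], the position of the root. What remains is that ordering by [vertex] is
    [lex_lt r]: descending in a component by the homomorphisms between neighbours, and ascending
    between components. *)
Lemma letter_onto : exists f : 'I_n -> 'I_n,
  (forall i, f (f i) = f i) /\ (forall j, letter f j = w j).
Proof.
pose r j := (sval (cid (rootedP j))).1; pose c j := (sval (cid (rootedP j))).2.
have rP j : [/\ w (r j) = (false, c j),
   w j = (vertex j != c j :> nat, vertex j - (c j < vertex j)) &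
   linked w (vertex j) (c j)].
  exact: svalP (cid (rootedP j)).
have link_root i j : linked w (vertex i) (c j) -> c i = c j /\ r i = r j.
  move=> l; have [wi _ li] := rP i; have [wj _ _] := rP j.
  have cE : c i = c j.
    apply: (link_eq wi wj) => e eP.
    case: (boolP ((vertex i <= e < c j) || (c j <= e < vertex i))) => [/l //|h].
    by apply: li; lia.
  by split=> //; apply: winj; rewrite wi wj cE.
have vr j : vertex (r j) = c j :> nat.
  have [wj _ _] := rP j; have [_ + _] := rP (r j).
  have -> : vertex (r j) = top (w (r j)) :> nat by [].
  by rewrite wj /top /= addn0 => -[]; lia.
have rr j : r (r j) = r j.
  by have [] // := link_root (r j) j; move=> e; rewrite vr; lia.
have vneq i j : vertex i = vertex j :> nat -> i = j.
  by move=> /val_inj/vertex_inj.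
have lt_succ i j : r i = r j -> vertex j = (vertex i).+1 :> nat -> j < i.
  move=> rij vij; have cij : c i = c j by rewrite -!vr rij.
  apply: (incompatible_ltn wcompat).
    by apply/eqP => E; move: vij; rewrite E; lia.
  have [_ -> _] := rP i; have [_ -> _] := rP j; rewrite cij vij.
  by rewrite /compatible /interval_hom /=; lia.
have lt_fibre m i j : r i = r j -> vertex j = vertex i + m.+1 :> nat -> j < i.
  elim: m i => [|m IH] i rij vij; first by apply: lt_succ => //; lia.
  have [|h hE] := @top_onto (vertex i).+1.
    by have := ltn_ord (vertex j); lia.
  have vh : vertex h = (vertex i).+1 :> nat by [].
  have [_ rh] : c h = c i /\ r h = r i.
    have cij : c i = c j by rewrite -!vr rij.
    apply: link_root => e eP.
    have [_ _ li] := rP i; have [_ _ lj] := rP j.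
    case: (boolP ((vertex i <= e < c i) || (c i <= e < vertex i))) =>
      [/li //|h'].
    by apply: lj; lia.
  have jh : j < h by apply: IH; [rewrite rh | rewrite vij vh; lia].
  by apply: ltn_trans jh _; apply: lt_succ.
have lt_root i j : r i < r j -> vertex i < vertex j.
  move=> rij; rewrite ltnNge; apply/negP => vij.
  have [wi _ li] := rP i; have [wj _ lj] := rP j.
  have := wcompat rij; rewrite wi wj /compatible /interval_hom /= => cij.
  (* Since [vertex j <= vertex i] and [c i <= c j], the two linked intervals cover the stretch
     between the roots. *)
  have cE : c i = c j.
    apply: (link_eq wi wj) => e eP.
    case: (boolP ((vertex i <= e < c i) || (c i <= e < vertex i))) =>
      [/li //|h'].
    by apply: lj; lia.
  by lia.
have vlt i j : (vertex i < vertex j) = lex_lt r i j.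
  rewrite /lex_lt; have [rij|rij|/val_inj rij] := ltngtP (r i) (r j).
  - by rewrite lt_root.
  - by have := lt_root _ _ rij; rewrite -val_eqE /=; lia.
  rewrite rij eqxx orFb andTb.
  have [ij|ij|/val_inj ->] := ltngtP j i; last by rewrite ltnn.
    rewrite ltnNge; apply/negP => vij; have vij' : vertex i != vertex j :> nat.
      by apply/eqP => /vneq E; move: ij; rewrite E; lia.
    have [m mE] : exists m, vertex i = vertex j + m.+1 :> nat.
      by exists (vertex i - vertex j).-1; lia.
    have := lt_fibre _ _ _ (esym rij) mE; lia.
  apply/negP => vij; have [m mE] : exists m, vertex j = vertex i + m.+1 :> nat.
    by exists (vertex j - vertex i).-1; lia.
  have := lt_fibre _ _ _ rij mE; lia.
exists r; split=> // j; have [_ -> _] := rP j.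
rewrite /letter (lex_rank_uniq vertex_inj vlt) -vr vlt /lex_lt rr ltnn eqxx /=.
congr pair; apply/idP/idP; apply: contraNN => /eqP.
  by move=> /vneq {1}->.
by move=> {1}->.
Qed.

End Surjectivity.

End Ranks.

Local Open Scope ring_scope.

(** * Matrices with at most one row and one column *)

Section ConstantMatrices.
Variable k : fieldType.

Lemma mul_const_mx p q r (a b : k) :
  (const_mx a : 'M_(p, q)) *m (const_mx b : 'M_(q, r)) = const_mx (a * b *+ q).
Proof.
apply/matrixP => i j; rewrite !mxE.
by under eq_bigr do rewrite !mxE; rewrite sumr_const card_ord.
Qed.

Lemma mx_no_rows p q (A B : 'M[k]_(p, q)) : p = 0%N -> A = B.
Proof. by move=> p0; apply/matrixP => -[i lti]; exfalso; rewrite p0 in lti. Qed.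

Lemma mx_no_cols p q (A B : 'M[k]_(p, q)) : q = 0%N -> A = B.
Proof.
by move=> q0; apply/matrixP => i [j ltj]; exfalso; rewrite q0 in ltj.
Qed.

(** The spaces of interval modules have a boolean as dimension; [const_mx] then names a scalar
    without casts. *)
Lemma bool_mx_const (p q : bool) (A : 'M[k]_(p, q)) :
  exists c, A = const_mx c.
Proof.
case: p A => A; last by exists 0; apply: mx_no_rows.
case: q A => A; last by exists 0; apply: mx_no_cols.
by exists (A ord0 ord0); apply/matrixP => i j; rewrite mxE !ord1.
Qed.

Lemma bool_const_mx1 (p : bool) : const_mx 1 = 1%:M :> 'M[k]_p.
Proof.
case: p; last exact: mx_no_rows.
by apply/matrixP => i j; rewrite !mxE !ord1.
Qed.

Lemma mxrank_bool_const (p q : bool) (c : k) :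
  \rank (const_mx c : 'M_(p, q)) = [&& p, q & c != 0].
Proof.
case: p; last by apply/eqP; rewrite -leqn0 rank_leq_row.
case: q; last by apply/eqP; rewrite -leqn0 rank_leq_col.
rewrite rank_rV /=; congr (nat_of_bool (~~ _)).
apply/eqP/eqP => [/matrixP/(_ ord0 ord0)|->]; first by rewrite !mxE.
by apply/matrixP => i j; rewrite !mxE.
Qed.

End ConstantMatrices.

(** * Homomorphisms, isomorphisms and bricks *)

Section Homs.
Variables (k : fieldType) (n : nat).
Implicit Types L M N P : rep k n.

Lemma hom_compA L M N P (h : hom N P) (g : hom M N) (f : hom L M) :
  hom_comp h (hom_comp g f) = hom_comp (hom_comp h g) f.
Proof. by apply: homP => i /=; rewrite mulmxA. Qed.

Lemma hom_comp0l L M N (f : hom L M) : hom_comp (0 : hom M N) f = 0.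
Proof. by apply: homP => i /=; rewrite mulmx0. Qed.

Lemma hom_comp0r L M N (g : hom M N) : hom_comp g (0 : hom L M) = 0.
Proof. by apply: homP => i /=; rewrite mul0mx. Qed.

Lemma hom_comp1l L M (f : hom L M) : hom_comp (hom_id M) f = f.
Proof. by apply: homP => i /=; rewrite mulmx1. Qed.

Lemma hom_comp1r L M (f : hom L M) : hom_comp f (hom_id L) = f.
Proof. by apply: homP => i /=; rewrite mul1mx. Qed.

Lemma hom_compZl L M N c (g : hom M N) (f : hom L M) :
  hom_comp (c *: g) f = c *: hom_comp g f.
Proof. by apply: homP => i /=; rewrite -scalemxAr. Qed.

Lemma hom_compZr L M N c (g : hom M N) (f : hom L M) :
  hom_comp g (c *: f) = c *: hom_comp g f.
Proof. by apply: homP => i /=; rewrite -scalemxAl. Qed.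

Lemma isomorphic_refl M : isomorphic M M.
Proof. by exists (hom_id M), (hom_id M); rewrite !hom_comp1l. Qed.

Lemma isomorphic_sym M N : isomorphic M N -> isomorphic N M.
Proof. by case=> f [g [gf fg]]; exists g, f. Qed.

Lemma isomorphic_trans L M N :
  isomorphic L M -> isomorphic M N -> isomorphic L N.
Proof.
move=> [f [g [gf fg]]] [f' [g' [gf' fg']]].
exists (hom_comp f' f), (hom_comp g g'); split.
  by rewrite -hom_compA (hom_compA g') gf' hom_comp1l.
by rewrite -hom_compA (hom_compA f) fg hom_comp1l.
Qed.

Lemma isoclassP M N : isomorphic M N <-> isoclass M = isoclass N.
Proof.
split=> [MN | MN]; last first.
  by rewrite -[isomorphic M N]/(isoclass M N) MN; exact: isomorphic_refl.
apply/seteqP; split=> L /= ?.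
  exact: isomorphic_trans (isomorphic_sym MN) _.
exact: isomorphic_trans MN _.
Qed.

Lemma isomorphic_dim M N i : isomorphic M N -> M i = N i.
Proof.
suff le (A B : rep k n) : isomorphic A B -> (A i <= B i)%N.
  by move=> MN; apply/eqP; rewrite eqn_leq !le //; exact: isomorphic_sym.
case=> f [g [gf _]].
have /= <- : \rank (hom_comp g f i) = A i by rewrite gf mxrank1.
exact: leq_trans (mxrankM_maxl _ _) (rank_leq_col _).
Qed.

Definition brick M : Prop :=
  ~ zero_rep M /\ forall f : hom M M, exists c, f = c *: hom_id M.

Lemma zero_rep_id M : hom_id M = 0 -> zero_rep M.
Proof.
move=> id0 i; have : hom_id M i = 0 by rewrite id0.
by move=> /= /(congr1 mxrank); rewrite mxrank1 mxrank0.
Qed.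

Lemma exceptional_brick M : exceptional M -> brick M.
Proof.
case=> -[nz _] [phi [psi _ phiK]] _; split=> // f.
have phiE (c : k) : phi c = c *: (phi (1 : k^o) : hom M M).
  by rewrite -linearZ /= [_ *: _]mulr1.
have := phiK (hom_id M); set s := psi (hom_id M); rewrite phiE => idE.
(* The bijection [phi] need not send 1 to the identity, so coefficients are rescaled by the preimage
   [s] of the identity. *)
exists (psi f / s); rewrite -{1}(phiK f) phiE -idE scalerA divfK //.
by apply/eqP => c0; apply: nz; apply: zero_rep_id; rewrite -idE c0 scale0r.
Qed.

(** The projection onto [A] gives an endomorphism of [M], hence a scalar [c]; [A] vanishes if
    [c = 0], and [B] otherwise. *)
Lemma brick_indecomposable M : brick M -> indecomposable M.
Proof.
move=> [nz scal]; split=> // A B [f [g [gf fg]]].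
pose e (i : 'I_n) : 'M[k]_(rep_sum A B i) := block_mx 1%:M 0 0 0.
have prc i j (a : arrow i j) :
    act (rep_sum A B) a *m e j = e i *m act (rep_sum A B) a.
  by rewrite /e /= !mulmx_block !(mulmx0, mul0mx, mul1mx, mulmx1, addr0, add0r).
have [c] := scal (hom_comp g (hom_comp (HomRep prc) f)).
move=> /(congr1 (fun h => hom_comp f (hom_comp h g))).
rewrite hom_compZl hom_comp1l hom_compZr fg !hom_compA fg hom_comp1l.
rewrite -hom_compA fg hom_comp1r => prE.
have {}prE i : block_mx 1%:M 0 0 0 = c%:M :> 'M_(A i + B i).
  by have := congr1 (fun h : hom _ _ => h i) prE; rewrite /= scalemx1.
have [c0|c0] := eqVneq c 0; [left|right] => i; move: (prE i);
  rewrite scalar_mx_block => /eq_block_mx[].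
  by rewrite c0 raddf0 => /(congr1 mxrank) + _ _ _; rewrite mxrank1 mxrank0.
move=> _ _ _ /(congr1 mxrank); rewrite mxrank0 -scalemx1 mxrank_scale_nz //.
by rewrite mxrank1.
Qed.

Lemma brick_exceptional M : brick M ->
  (forall i, (1 <= i)%N -> Ext_zero i M M) -> exceptional M.
Proof.
move=> bM ext; split=> //; first exact: brick_indecomposable.
case: bM => nz scal.
pose phi (c : k^o) : hom M M := (c : k) *: hom_id M.
have phiD : linear phi by move=> c a b; rewrite /phi scalerDl scalerA.
pose L := GRing.isLinear.Build _ _ _ _ phi phiD.
pose phiL : {linear k^o -> hom M M} := HB.pack phi L.
exists phiL => /=; have inv (f : hom M M) : {c | f = c *: hom_id M}.
  exact/cid/scal.
exists (fun f => sval (inv f)) => [c|f]; last first.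
  by rewrite /= /phi -(svalP (inv f)).
case: (inv _) => /= d; rewrite /phi => /eqP; rewrite -subr_eq0 -scalerBl.
move=> /eqP cd; apply/eqP; rewrite -subr_eq0; apply/negPn/negP => nzd.
apply: nz; apply: zero_rep_id; apply: (scalerI (a := d - c)) => //.
by rewrite scaler0 -[RHS]oppr0 -cd -scaleNr opprB.
Qed.

(** As [M] is a brick, [gf] is a scalar [c]; computing [fgfg] in two ways gives [s^2 = cs], so
    [c = s]. *)
Lemma brick_summand M N (f : hom M N) (g : hom N M) (s : k) :
  brick M -> ~ zero_rep N -> s != 0 -> hom_comp f g = s *: hom_id N ->
  isomorphic M N.
Proof.
move=> [_ scal] nz s0 fg; have [c gf] := scal (hom_comp g f).
exists f, (s^-1 *: g); rewrite hom_compZl hom_compZr fg gf !scalerA mulVf //.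
rewrite scale1r; split=> //.
suff -> : c = s by rewrite mulVf // scale1r.
have : hom_comp (hom_comp f g) (hom_comp f g) =
       c *: hom_comp f g.
  by rewrite -hom_compA (hom_compA g) gf hom_compZl hom_comp1l hom_compZr.
rewrite fg hom_compZl hom_comp1l !scalerA => /eqP.
rewrite -subr_eq0 -scalerBl -mulrBl => /eqP E0.
apply/eqP; rewrite eq_sym -subr_eq0; apply/negPn/negP => nzd.
apply: nz; apply: zero_rep_id; apply: (scalerI (a := (s - c) * s)).
  by rewrite mulf_neq0.
by rewrite scaler0.
Qed.

Lemma isomorphic_row_free M N (f : hom M N) (g : hom N M) i :
  hom_comp g f = hom_id M -> row_free (f i).
Proof.
move=> gf; apply/row_freeP; exists (g i).
exact: (congr1 (fun h : hom _ _ => h i) gf).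
Qed.

Lemma Ext_zero_isoE M N N' i :
  isomorphic N N' -> Ext_zero i M N -> Ext_zero i M N'.
Proof.
move=> [f [g [gf fg]]] [P PE]; exists P => h /= hd.
have := PE (hom_comp g h); rewrite /cocycles /mkset -hom_compA hd hom_comp0r.
move=> /(_ erefl).
case: i h {PE} hd => [|i] h hd; rewrite /coboundaries /mkset.
  move=> /(congr1 (hom_comp f)).
  by rewrite -/(hom_comp f (hom_comp g h)) hom_compA fg hom_comp1l hom_comp0r.
case=> h' _ h'E; exists (hom_comp f h') => //.
by rewrite -hom_compA h'E hom_compA fg hom_comp1l.
Qed.

(** The same resolution serves [M'], with the isomorphism composed onto its augmentation. *)
Lemma Ext_zero_isoD M M' N i :
  isomorphic M M' -> Ext_zero i M N -> Ext_zero i M' N.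
Proof.
move=> [f [g [gf fg]]] [P PE].
have epi' : epi (hom_comp f (res_aug P)).
  move=> l /=; rewrite /row_full mxrankMfree; last first.
    exact: isomorphic_row_free gf.
  rewrite (eqP (res_epi P l)); apply/eqP/isomorphic_dim.
  by exists f, g.
have ex' : exact_at (res_diff P 0) (hom_comp f (res_aug P)).
  move=> l /=; have /andP[s1 s2] := res_exact0 P l.
  apply/andP; split.
    by rewrite (submx_trans s1) // sub_kermx mulmxA mulmx_ker mul0mx.
  apply: submx_trans s2; rewrite sub_kermx.
  apply/eqP/(row_free_inj (isomorphic_row_free l gf)).
  by rewrite mul0mx -mulmxA mulmx_ker.
by exists (@ProjectiveResolution k n M' _ _ _ (@res_proj _ _ _ P) epi' ex'
  (@res_exact _ _ _ P)).
Qed.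

End Homs.

(** * Interval modules, their homomorphisms and extensions *)

Section Thin.
Variables (k : fieldType) (n : nat).
Implicit Types (M N : rep k n) (t u : bool) (a b c : nat).

Definition thin_dim t c (i : 'I_n) : bool := (c <= i <= c + t)%N.

Definition thin_act t c (i j : 'I_n) (_ : arrow i j) :
    'M[k]_(thin_dim t c i, thin_dim t c j) :=
  const_mx (t && (i == c :> nat))%:R.

Fact thin_rad2 t c (i j l : 'I_n) (x : arrow i j) (y : arrow j l) :
  thin_act t c x *m thin_act t c y = 0.
Proof.
rewrite mul_const_mx -natrM mulnb andbACA.
have /andP[_ /negbTE->] : true && ~~ ((i == c :> nat) && (j == c :> nat)).
  by rewrite /arrow in x; lia.
by rewrite andbF mul0rn; apply/matrixP => ? ?; rewrite !mxE.
Qed.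

(* The simple module at vertex c is [thin false c] and the indecomposable
   projective is [thin true c]; both vanish for n <= c. *)
Definition thin t c : rep k n := Rep (@thin_rad2 t c).

Lemma thin_out t c (i : 'I_n) : ~~ thin_dim t c i -> thin t c i = 0%N.
Proof. by move=> /= /negbTE->. Qed.

(** The module is generated by its top, at vertex [c]. *)
Lemma thin_hom_ext t c N (f g : hom (thin t c) N) :
  (forall i : 'I_n, i = c :> nat -> f i = g i) -> f = g.
Proof.
move=> fg; apply: homP => j.
have [jc|jc] := eqVneq (j : nat) c; first exact: fg.
have [|out] := boolP (thin_dim t c j); last first.
  by apply: mx_no_rows; exact: thin_out.
rewrite /thin_dim => jP; have cn : (c < n)%N by have := ltn_ord j; lia.
pose i := Ordinal cn; have ij : arrow i j by rewrite /arrow /=; lia.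
have tT : t by lia.
have act1 : const_mx 1 *m act (thin t c) ij = 1%:M.
  rewrite /= /thin_act mul_const_mx -bool_const_mx1 /= tT eqxx /thin_dim /=.
  by rewrite leqnn leq_addr !mulr1.
by rewrite -[f j]mul1mx -[g j]mul1mx -act1 -!mulmxA !hom_comm fg.
Qed.

(* X is a family over all vertices only to avoid transporting a single row
   vector along an equality of vertices. *)
Lemma proj_hom (i : 'I_n) N (X : forall l, 'rV[k]_(N l)) :
  exists h : hom (thin true i) N, h i = const_mx 1 *m X i.
Proof.
pose h l : 'M[k]_(thin true i l, N l) := match @idP (arrow i l) with
  | ReflectT a => const_mx 1 *m X i *m act N a
  | ReflectF _ => const_mx 1 *m X l end.
have hc (j l : 'I_n) (a : arrow j l) :
    act (thin true i) a *m h l = h j *m act N a.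
  rewrite /h; have [ij|ij] := eqVneq j i.
    subst j; case: {-}_ / idP => [a'|]; last by case/(_ a).
    case: {-}_ / idP => [a''|_].
      by exfalso; move: a''; rewrite /arrow; lia.
    rewrite (bool_irrelevance a' a) /= /thin_act eqxx !mulmxA mul_const_mx.
    have -> : thin_dim true i l = true.
      by move: a; rewrite /arrow /thin_dim; lia.
    by rewrite mulr1.
  have -> : act (thin true i) a = 0.
    rewrite /= /thin_act; move: ij; rewrite -val_eqE /= => /negbTE->.
    by apply/matrixP => ? ?; rewrite !mxE.
  rewrite mul0mx; case: {-}_ / idP => [a'|na].
    by rewrite -mulmxA act_rad2 mulmx0.
  apply: mx_no_rows; apply: thin_out; move: ij na.
  by rewrite -val_eqE /arrow /thin_dim /=; lia.
exists (HomRep hc); rewrite /= /h.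
by case: {-}_ / idP => [a|//]; exfalso; move: a; rewrite /arrow; lia.
Qed.

Lemma thin_projective c : projective (thin true c).
Proof.
move=> M N p f epi_p; have [cn|nc] := ltnP c n; last first.
  exists 0; apply: thin_hom_ext => i ic.
  by have := ltn_ord i; lia.
(* Only the image of the generator has to be lifted along [p]; [proj_hom] extends the lift. *)
pose i := Ordinal cn; pose X l : 'rV_(M l) := const_mx 1 *m f l *m pinvmx (p l).
have [h hE] := @proj_hom i M X; exists h.
apply: thin_hom_ext => l lc; have -> : l = i by apply: val_inj.
have Xp : X i *m p i = const_mx 1 *m f i by rewrite mulmxKpV // submx_full.
by rewrite /= hE -mulmxA Xp mulmxA mul_const_mx mulr1 bool_const_mx1 mul1mx.
Qed.

(** The constant is 0 where [interval_hom] fails, which makes [can_hom] total. *)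
Fact can_hom_comm u b t a (i j : 'I_n) (x : arrow i j) :
  let c := (interval_hom (u, b) (t, a))%:R : k in
  act (thin u b) x *m (const_mx c : 'M_(_, thin t a j)) =
  (const_mx c : 'M_(thin u b i, _)) *m act (thin t a) x.
Proof.
rewrite /= /thin_act !mul_const_mx.
have [iP|iP] := boolP (thin_dim u b i); last by apply: mx_no_rows.
have [jP|jP] := boolP (thin_dim t a j); last by apply: mx_no_cols.
apply/matrixP => r s; rewrite !mxE -!natrM -!mulrnA; congr _%:R.
rewrite /thin_dim /arrow /interval_hom /= in x iP jP *.
by case: t u jP iP => -[]; lia.
Qed.

Definition can_hom u b t a : hom (thin u b) (thin t a) :=
  HomRep (@can_hom_comm u b t a).

Lemma thin_hom_scalar u b t a (f : hom (thin u b) (thin t a)) :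
  exists c : k, forall i : 'I_n, i = b :> nat -> f i = const_mx c.
Proof.
have [bn|nb] := ltnP b n; last by exists 0 => i ib; have := ltn_ord i; lia.
have [c fc] := bool_mx_const (f (Ordinal bn)).
by exists c => i ib; have -> : i = Ordinal bn by apply: val_inj.
Qed.

Lemma thin_hom_can u b t a (f : hom (thin u b) (thin t a)) : (a + t < n)%N ->
  exists c : k, f = c *: can_hom u b t a.
Proof.
move=> an; have [c fc] := thin_hom_scalar f; exists c.
apply: thin_hom_ext => i ib.
rewrite (fc _ ib) /=; have [/= hP|hP] := boolP (interval_hom _ _).
  by apply/matrixP => ? ?; rewrite !mxE mulr1.
have -> : (c *: const_mx 0 : 'M_(thin_dim u b i, thin_dim t a i)) = 0.
  by apply/matrixP => ? ?; rewrite !mxE mulr0.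
have [iP|iP] := boolP (thin_dim t a i); last first.
  by apply: mx_no_cols.
rewrite /thin_dim /interval_hom /= in hP iP.
(* What is left is a map from S_a to P_a: the arrow of P_a is injective on its top, yet must kill
   the image. *)
have [ti ui ia] : [/\ t, ~~ u & i = a :> nat] by split; lia.
have jn : (i.+1 < n)%N by lia.
have ij : arrow i (Ordinal jn) by rewrite /arrow.
have f0 : f (Ordinal jn) = 0.
  by apply: mx_no_rows; apply: thin_out; rewrite /thin_dim /=; lia.
have := hom_comm f ij; rewrite f0 (fc _ ib).
have tia : t && (i == a :> nat) by rewrite ti ia eqxx.
have sj : (0 < thin_dim t a (Ordinal jn))%N by rewrite /thin_dim /=; lia.
rewrite mulmx0 /= /thin_act mul_const_mx tia mulr1 => /matrixP E.
apply/matrixP => r s; rewrite !mxE; have := E r (Ordinal sj).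
by rewrite !mxE (_ : thin_dim t a i = true) // => <-.
Qed.

Lemma thin_hom0 u b t a (f : hom (thin u b) (thin t a)) : (a + t < n)%N ->
  ~~ interval_hom (u, b) (t, a) -> f = 0.
Proof.
move=> an /negbTE nh; have [c ->] := thin_hom_can f an.
apply: homP => i /=; rewrite nh.
by apply/matrixP => ? ?; rewrite !mxE mulr0.
Qed.

Lemma can_hom_neq0 u b t a : (b < n)%N -> interval_hom (u, b) (t, a) ->
  can_hom u b t a <> 0.
Proof.
move=> bn hP /(congr1 (fun h : hom _ _ => h (Ordinal bn))) /= /matrixP.
have ub : (0 < thin_dim u b (Ordinal bn))%N by rewrite /thin_dim /=; lia.
have ta : (0 < thin_dim t a (Ordinal bn))%N.
  by move: hP; rewrite /interval_hom /thin_dim /=; lia.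
move=> /(_ (Ordinal ub) (Ordinal ta)); rewrite !mxE hP => /eqP.
by rewrite oner_eq0.
Qed.

Lemma can_hom_id t a : can_hom t a t a = hom_id (thin t a).
Proof.
apply: homP => i /=; rewrite -bool_const_mx1; congr const_mx.
by rewrite (_ : interval_hom _ _) // /interval_hom; lia.
Qed.

Lemma thin_brick t a : (a + t < n)%N -> brick (thin t a).
Proof.
move=> an; split=> [z|f].
  have bn : (a < n)%N by lia.
  by have := z (Ordinal bn); rewrite /= /thin_dim /= leqnn leq_addr.
by have [c fE] := thin_hom_can f an; exists c; rewrite -can_hom_id.
Qed.

Lemma thin_isomorphic_inj t a u b : (a + t < n)%N -> (b + u < n)%N ->
  isomorphic (thin t a) (thin u b) -> (t, a) = (u, b).
Proof.
move=> an bn iso; have dE (i : 'I_n) : thin_dim t a i = thin_dim u b i :> nat.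
  exact: isomorphic_dim iso.
have an' : (a < n)%N by lia.
have bn' : (b < n)%N by lia.
move: (dE (Ordinal an')) (dE (Ordinal bn')) (dE (Ordinal an)) (dE (Ordinal bn)).
by rewrite /thin_dim /= => *; congr pair; lia.
Qed.

Lemma thin_zero (c : nat) : (n <= c)%N -> zero_rep (thin true c : rep k n).
Proof.
by move=> nc i; apply: thin_out; have := ltn_ord i; rewrite /thin_dim; lia.
Qed.

(** [thin true n] is the zero module, in a form already known to be projective. *)
Definition proj_res_obj a i : rep k n :=
  if i is _.+1 then thin true n else thin true a.

Lemma proj_resolution a :
  exists P : projective_resolution (thin true a : rep k n),
  forall i, zero_rep (res_obj P i.+1).
Proof.
have proj i : projective (proj_res_obj a i).
  by case: i => [|i]; exact: thin_projective.
have e : epi (hom_id (thin true a : rep k n)).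
  by move=> i; rewrite /row_full /= mxrank1.
pose d i : hom (proj_res_obj a i.+1) (proj_res_obj a i) := 0.
have ex0 : exact_at (d 0%N) (hom_id _).
  move=> i /=; have -> : kermx (1%:M : 'M[k]_(thin_dim true a i)) = 0.
    by apply/eqP; rewrite kermx_eq0 /row_free mxrank1.
  by rewrite !sub0mx.
have ex i : exact_at (d i.+1) (d i).
  move=> j; have -> : kermx (d i j) = 0 by apply: mx_no_rows; exact: thin_zero.
  by rewrite /= !sub0mx.
by exists (ProjectiveResolution proj e ex0 ex) => i; exact: thin_zero.
Qed.

Lemma exact_at_rank L M N (f : hom L M) (g : hom M N) :
  hom_comp g f = 0 -> (forall i, \rank (f i) + \rank (g i) = M i)%N ->
  exact_at f g.
Proof.
move=> gf rk i; have sub : (f i <= kermx (g i))%MS.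
  by rewrite sub_kermx; apply/eqP; exact: (congr1 (fun h : hom _ _ => h i) gf).
by rewrite -(geq_leqif (mxrank_leqif_eq sub)) mxrank_ker leq_subLR addnC rk.
Qed.

(** Start of the resolution ... -> P_(b+1) -> P_b -> S_b; writing [b + 0] makes it fit the family
    [thin true (b + i)]. *)
Definition simple_aug b : hom (thin true (b + 0)) (thin false b) :=
  can_hom true (b + 0) false b.

Definition simple_diff b i : hom (thin true (b + i.+1)) (thin true (b + i)) :=
  can_hom true (b + i.+1) true (b + i).

Lemma mxrank_can_hom u b t a (i : 'I_n) : \rank (can_hom u b t a i) =
  [&& thin_dim u b i, thin_dim t a i & interval_hom (u, b) (t, a)].
Proof.
by rewrite mxrank_bool_const; case: interval_hom; rewrite ?oner_eq0 ?eqxx.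
Qed.

Fact simple_epi b : epi (simple_aug b).
Proof.
move=> i; rewrite /row_full mxrank_can_hom /= /thin_dim /interval_hom /=; lia.
Qed.

Fact simple_exact0 b : exact_at (simple_diff b 0) (simple_aug b).
Proof.
apply: exact_at_rank => [|i].
  apply: thin_hom_ext => i ib /=; apply: mx_no_cols; apply: thin_out.
  by rewrite /thin_dim; lia.
by rewrite !mxrank_can_hom /= /thin_dim /interval_hom /=; lia.
Qed.

Fact simple_exact b i : exact_at (simple_diff b i.+1) (simple_diff b i).
Proof.
apply: exact_at_rank => [|j].
  apply: thin_hom_ext => j jb /=; apply: mx_no_cols; apply: thin_out.
  by rewrite /thin_dim; lia.
by rewrite !mxrank_can_hom /= /thin_dim /interval_hom /=; lia.
Qed.

Definition simple_resolution b : projective_resolution (thin false b) :=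
  ProjectiveResolution (fun i => @thin_projective (b + i)) (@simple_epi b)
    (@simple_exact0 b) (@simple_exact b).

(** A projective source has a resolution of length 0. From S_b, a nonzero map P_(b+m) -> P_a is a
    multiple of the differential, so a coboundary, or of the identity, and then not a cocycle
    because the next differential is nonzero. *)
Lemma Ext_zero_thin u b t a m : (0 < m)%N -> (a + t < n)%N ->
  [|| u, t | a != b + m]%N -> Ext_zero m (thin u b) (thin t a).
Proof.
case: m => // m _ an; case: u => /= [_|nta].
  have [P Pz] := proj_resolution b; exists P => f _; exists 0 => //.
  by apply: homP => i; apply: mx_no_rows; exact: Pz.
exists (simple_resolution b) => f fd.
have [c fE] := thin_hom_can (f : hom (thin true (b + m.+1)) _) an.
have [hP|hP] := boolP (interval_hom (true, b + m.+1)%N (t, a)); last first.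
  exists 0 => //; rewrite [LHS]/= hom_comp0l.
  exact/esym/thin_hom0.
have tT : t = true by move: hP nta; rewrite /interval_hom /=; lia.
subst t; have [aE|aE] := eqVneq a (b + m)%N.
  by subst a; exists (c *: hom_id _) => //; rewrite hom_compZl hom_comp1l fE.
have {}aE : a = (b + m.+1)%N by move: hP aE; rewrite /interval_hom /=; lia.
exists 0 => //; rewrite [LHS]/= hom_comp0l.
subst a; move: fd; rewrite /cocycles /mkset fE hom_compZl can_hom_id hom_comp1l.
case: (eqVneq c 0) => [-> _|c0 /(congr1 (fun g => c^-1 *: g))].
  by rewrite scale0r.
rewrite scalerA mulVf // scale1r scaler0.
by move=> /can_hom_neq0 []; rewrite /interval_hom /=; lia.
Qed.

(** Dual to [proj_hom]: [thin true i] is also injective with socle at [j], so a linear form at [j]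
    induces a homomorphism. *)
Lemma inj_hom (i j : 'I_n) (a : arrow i j) M (Y : forall l, 'cV[k]_(M l)) :
  exists h : hom M (thin true i), h i = act M a *m Y j *m const_mx 1.
Proof.
pose h l : 'M[k]_(M l, thin true i l) := match @idP (arrow l j) with
  | ReflectT a => act M a *m Y j *m const_mx 1
  | ReflectF _ => Y l *m const_mx 1 end.
have hc (l l' : 'I_n) (x : arrow l l') :
    act M x *m h l' = h l *m act (thin true i) x.
  rewrite /h; have [lj|lj] := eqVneq l' j.
    have li : l = i.
      by apply: val_inj; move: lj a x; rewrite /arrow /= => ->; lia.
    subst l' l; case: {-}_ / idP => [x'|_].
      by exfalso; move: x'; rewrite /arrow; lia.
    case: {-}_ / idP => [x'|]; last by case/(_ x).
    rewrite (bool_irrelevance x' x) /= /thin_act eqxx -!mulmxA mul_const_mx.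
    have -> : thin_dim true i i = true by rewrite /thin_dim; lia.
    by rewrite mulr1.
  have -> : act (thin true i) x = 0.
    rewrite /= /thin_act; have [li|_] := eqVneq (l : nat) i; last first.
      by apply/matrixP => ? ?; rewrite !mxE.
    by exfalso; move: lj a x; rewrite /arrow -val_eqE /=; lia.
  rewrite mulmx0; case: {-}_ / idP => [a'|na].
    by rewrite !mulmxA act_rad2 !mul0mx.
  apply: mx_no_cols; apply: thin_out; move: lj na a.
  by rewrite -val_eqE /arrow /thin_dim /=; lia.
exists (HomRep hc); rewrite /= /h.
case: {-}_ / idP => [a'|]; last by case/(_ a).
by rewrite (bool_irrelevance a' a).
Qed.

(** A plain number as index gives a row at every vertex, the family [proj_hom] expects. *)
Definition unit_row M p l : 'rV[k]_(M l) := \row_z (z == p :> nat)%:R.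

Lemma unit_rowE M l (p : 'I_(M l)) : unit_row M p l = delta_mx 0 p.
Proof. by apply/matrixP => r z; rewrite !mxE ord1 eqxx. Qed.

Lemma thin_dim_self t (i : 'I_n) : thin_dim t i i.
Proof. by rewrite /thin_dim leqnn leq_addr. Qed.

(** A nonzero entry [(p, q)] of an arrow is the composite P_i -> M -> P_i of the map of basis vector
    [p] and the map of coordinate [q], so [brick_summand] applies. If all arrows vanish, a nonzero
    space splits off a simple likewise. *)
Lemma brick_thin M : brick M ->
  exists (t : bool) (a : nat), (a + t < n)%N /\ isomorphic M (thin t a).
Proof.
move=> bM; have [[i [j [a]]]|act0] :=
    pselect (exists (i j : 'I_n) (a : arrow i j), act M a != 0).
  move=> /matrix0Pn[p [q s0]]; exists true, (i : nat).
  have an : (i + true < n)%N by move: (a) (ltn_ord j); rewrite /arrow; lia.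
  split=> //.
  have [g gE] := proj_hom i (unit_row M p).
  have [f fE] := inj_hom a (fun l => (unit_row M q l)^T).
  have [nz _] := thin_brick an.
  apply: (brick_summand (f := f) (g := g) bM nz s0).
  apply: thin_hom_ext => l li; have -> : l = i by apply: val_inj.
  rewrite /= gE fE !unit_rowE trmx_delta -!mulmxA.
  rewrite (mulmxA (act M a)) -colE (mulmxA (delta_mx _ _)) -rowE.
  have -> : row p (col q (act M a)) = const_mx (act M a p q).
    by apply/matrixP => ? ?; rewrite !mxE.
  rewrite !mul_const_mx -bool_const_mx1 mulr1 mul1r.
  by apply/matrixP => ? ?; rewrite !mxE mulr1.
have {}act0 (i j : 'I_n) (a : arrow i j) : act M a = 0.
  by apply/eqP/negPn/negP => a0; apply: act0; exists i, j, a.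
have [i Mi] : exists i, M i <> 0%N by apply/existsNP; case: bM.
exists false, (i : nat); have an : (i + false < n)%N by rewrite addn0.
split=> //.
have thin0 (l l' : 'I_n) (a : arrow l l') : act (thin false i) a = 0.
  by apply/matrixP => ? ?; rewrite !mxE.
have gc (l l' : 'I_n) (a : arrow l l') : act (thin false i) a *m
  (const_mx 1 *m unit_row M 0 l') = const_mx 1 *m unit_row M 0 l *m act M a.
  by rewrite thin0 act0 mul0mx mulmx0.
have fc (l l' : 'I_n) (a : arrow l l') : act M a *m
  ((unit_row M 0 l')^T *m const_mx 1) =
  (unit_row M 0 l)^T *m const_mx 1 *m act (thin false i) a.
  by rewrite thin0 act0 mul0mx mulmx0.
have [nz _] := thin_brick an.
apply: (brick_summand (f := HomRep fc) (g := HomRep gc) bM nz (oner_neq0 k)).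
apply: thin_hom_ext => l li; have -> : l = i by apply: val_inj.
have Mi0 : (0 < M i)%N by rewrite lt0n; apply/eqP.
rewrite /= scale1r (unit_rowE (Ordinal Mi0)) trmx_delta.
rewrite -!mulmxA (mulmxA (delta_mx _ _)) mul_delta_mx.
have -> : delta_mx 0 0 = const_mx 1 :> 'M[k]_1.
  by apply/matrixP => ? ?; rewrite !mxE !ord1.
by rewrite !mul_const_mx !mulr1 -bool_const_mx1.
Qed.

Lemma exact_comp0 L M N (f : hom L M) (g : hom M N) :
  exact_at f g -> hom_comp g f = 0.
Proof.
move=> ex; apply: homP => i; apply/eqP; rewrite -sub_kermx.
by case/andP: (ex i).
Qed.

Lemma exact_sub L M N (f : hom L M) (g : hom M N) i (x : 'rV_(M i)) :
  exact_at f g -> x *m g i = 0 -> (x <= f i)%MS.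
Proof.
move=> ex xg; case/andP: (ex i) => _; apply: submx_trans.
by rewrite sub_kermx xg.
Qed.

(* The kernel of the projective at i over its simple top is the simple at j. *)
Lemma factor_socle (i j : 'I_n) (a : arrow i j) M (h : hom M (thin true i)) :
  hom_comp (can_hom true i false i) h = 0 ->
  exists f : hom M (thin false j), f j = h j *m const_mx 1.
Proof.
move=> h0; have hi0 : h i = 0.
  have := congr1 (fun g : hom _ _ => g i *m
    (const_mx 1 : 'M_(thin false i i, thin true i i))) h0.
  rewrite /= mul0mx -mulmxA mul_const_mx.
  have -> : interval_hom (true, i : nat) (false, i : nat).
    by rewrite /interval_hom /=; lia.
  by rewrite (thin_dim_self false) mulr1 bool_const_mx1 mulmx1.
have fc (l l' : 'I_n) (x : arrow l l') : act M x *m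
    (h l' *m (const_mx 1 : 'M_(_, thin false j l'))) =
    h l *m const_mx 1 *m act (thin false j) x.
  have [lj|lj] := eqVneq l' j; last first.
    apply: mx_no_cols; apply: thin_out; rewrite /thin_dim; move: lj.
    by rewrite -val_eqE /=; lia.
  have li : l = i by apply: val_inj; move: lj a x; rewrite /arrow /= => ->; lia.
  by subst l' l; rewrite mulmxA hom_comm hi0 !mul0mx.
by exists (HomRep fc).
Qed.

(** * Nonzero Ext classes between simples *)

Section SimpleExt.
Variables (b : 'I_n) (P : projective_resolution (thin false b : rep k n)).

(* f is the class of Ext^m between simples m steps apart; the element x of P_m
   shows that f does not vanish, and successive x are related by
   d(x_(m+1)) = x_m * arrow. *)
Definition ext_witness m (i : 'I_n) (f : hom (res_obj P m) (thin false i))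
    (x : 'rV[k]_(res_obj P m i)) : Prop :=
  [/\ hom_comp f (res_diff P m) = 0, x *m f i <> 0
    & forall l (a : arrow i l),
        (x *m act (res_obj P m) a <= res_diff P m l)%MS].

Lemma ext_witness0 :
  exists (f : hom (res_obj P 0) (thin false b)) x, ext_witness f x.
Proof.
pose x : 'rV[k]_(res_obj P 0 b) :=
  (const_mx 1 : 'M_(1, thin false b b)) *m pinvmx (res_aug P b).
have xE : x *m res_aug P b = const_mx 1.
  by rewrite mulmxKpV // submx_full //; exact: res_epi.
exists (res_aug P), x; split; first exact/exact_comp0/res_exact0.
  have p0 : (0 < thin false b b)%N by rewrite /= thin_dim_self.
  rewrite xE => /matrixP/(_ 0 (Ordinal p0)); rewrite !mxE => /eqP.
  by rewrite oner_eq0.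
move=> l a; apply: exact_sub (res_exact0 P) _.
apply: mx_no_cols; apply: thin_out; move: a.
by rewrite /arrow /thin_dim; lia.
Qed.

(** Dimension shift along 0 -> S_j -> P_i -> S_i -> 0: lift [f] to [h] into P_i; then [h] after the
    differential lands in the socle S_j and is the next class. *)
Lemma ext_witnessS m (i j : 'I_n) (a : arrow i j)
    (f : hom (res_obj P m) (thin false i)) x : ext_witness f x ->
  exists (g : hom (res_obj P m.+1) (thin false j)) y,
    ext_witness g y /\ y *m res_diff P m j = x *m act (res_obj P m) a.
Proof.
case=> fd xf xd.
have epi_top : epi (can_hom true i false i).
  move=> l; rewrite /row_full mxrank_can_hom /= /thin_dim /interval_hom /=.
  by lia.
have [h hf] := (@res_proj _ _ _ P m) _ _ _ f epi_top.
have [|g gE] := @factor_socle i j a _ (hom_comp h (res_diff P m)).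
  by rewrite hom_compA hf fd.
pose y := x *m act (res_obj P m) a *m pinvmx (res_diff P m j).
have yE : y *m res_diff P m j = x *m act (res_obj P m) a by rewrite mulmxKpV.
have dd : hom_comp (res_diff P m) (res_diff P m.+1) = 0.
  exact/exact_comp0/res_exact.
exists g, y; split=> //; split.
- apply: homP => l; have [->|lj] := eqVneq l j.
    rewrite /= gE /= !mulmxA.
    have := congr1 (fun u : hom _ _ => u j) dd => /= ->.
    by rewrite !mul0mx.
  apply: mx_no_cols; apply: thin_out; rewrite /thin_dim; move: lj.
  by rewrite -val_eqE /=; lia.
(* The value of [g] at [y] is that of [f] at [x], carried along the bijective arrow of
   [thin true i]. *)
- rewrite gE /= !mulmxA yE -(mulmxA x _ (h j)) (hom_comm h a) => yg; apply: xf.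
  have hi : h i = f i *m const_mx 1.
    rewrite -hf /= -mulmxA mul_const_mx.
    have -> : interval_hom (true, i : nat) (false, i : nat).
      by rewrite /interval_hom /=; lia.
    by rewrite (thin_dim_self false) mulr1 bool_const_mx1 mulmx1.
  have := congr1 (fun z => z *m (const_mx 1 : 'M_(_, thin false i i))) yg.
  rewrite hi mul0mx /= /thin_act -!mulmxA !mul_const_mx eqxx.
  rewrite (thin_dim_self false j) (thin_dim_self true i).
  have -> : thin_dim true i j by move: (a); rewrite /arrow /thin_dim; lia.
  by rewrite !mulr1 bool_const_mx1 mulmx1.
move=> l a'; apply: exact_sub (@res_exact _ _ _ P m) _.
by rewrite -mulmxA hom_comm mulmxA yE -mulmxA act_rad2 mulmx0.
Qed.

Lemma ext_witness_ex m (i : 'I_n) : i = (b + m)%N :> nat ->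
  exists (f : hom (res_obj P m) (thin false i)) x, ext_witness f x.
Proof.
elim: m i => [|m IH] i iE.
  have -> : i = b by apply: val_inj; rewrite /= iE addn0.
  exact: ext_witness0.
have hn : (b + m < n)%N by have := ltn_ord i; lia.
have [f [x fx]] := IH (Ordinal hn) erefl.
have a : arrow (Ordinal hn) i by rewrite /arrow iE /= addnS.
by have [g [y [gy _]]] := ext_witnessS a fx; exists g, y.
Qed.

(** A coboundary through [h] takes at [y] the value of [h] at [x] times an arrow, which factors
    through the target simple at vertex [b + m], where it is zero. *)
Lemma simple_cocycle m (i : 'I_n) : i = (b + m.+1)%N :> nat ->
  ~ (@cocycles _ _ _ P (thin false i) m.+1 `<=`
     @coboundaries _ _ _ P _ m.+1)%classic.
Proof.
move=> iE sub; have hn : (b + m < n)%N by have := ltn_ord i; lia.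
have [f [x fx]] := ext_witness_ex (erefl : Ordinal hn = (b + m)%N :> nat).
have a : arrow (Ordinal hn) i by rewrite /arrow iE /= addnS.
have [g [y [[gd yg _] yd]]] := ext_witnessS a fx.
have [h _ hE] := sub g gd; apply: yg.
rewrite -hE /= mulmxA yd -(mulmxA x) (hom_comm h a).
rewrite (mx_no_cols (h (Ordinal hn)) 0) ?mul0mx ?mulmx0 //.
by apply: thin_out; rewrite /thin_dim /=; lia.
Qed.

End SimpleExt.

(** One resolution suffices for [Ext_zero], so its failure is a claim about all of them. *)
Lemma Ext_simple_nonzero b m : (b + m.+1 < n)%N ->
  ~ Ext_zero m.+1 (thin false b : rep k n) (thin false (b + m.+1)).
Proof.
move=> hn; have bn : (b < n)%N by lia.
by move=> [P]; exact: (@simple_cocycle (Ordinal bn) P m (Ordinal hn)).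
Qed.

(** * Exceptional pairs of interval modules *)

Lemma thin_exceptional t a : (a + t < n)%N -> exceptional (thin t a).
Proof.
move=> an; apply: brick_exceptional; first exact: thin_brick.
by move=> m m0; apply: Ext_zero_thin => //; lia.
Qed.

Lemma compatible_exceptional_pair (x y : bool * nat) :
  (x.2 + x.1 < n)%N -> (y.2 + y.1 < n)%N -> compatible x y ->
  exceptional_pair (thin x.1 x.2) (thin y.1 y.2).
Proof.
case: x y => t a [u b] /= an bn /andP[nh ext].
split; [exact: thin_exceptional | exact: thin_exceptional | | ] => [f|m m0].
  exact: thin_hom0.
by apply: Ext_zero_thin => //=; move: ext => /=; lia.
Qed.

Lemma exceptional_pair_compatible M N (x y : bool * nat) :
  (x.2 + x.1 < n)%N -> (y.2 + y.1 < n)%N ->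
  isomorphic M (thin x.1 x.2) -> isomorphic N (thin y.1 y.2) ->
  exceptional_pair M N -> compatible x y.
Proof.
case: x y => t a [u b] /= an bn isoM isoN [_ _ hom0 ext0].
apply/andP; split.
  apply/negP => /can_hom_neq0; apply; first lia.
  have [f [f' [_ ff']]] := isoM; have [g [g' [_ gg']]] := isoN.
  set c := can_hom _ _ _ _.
  (* Conjugating by the isomorphisms makes [c] a homomorphism from [N] to [M], where Hom
     vanishes. *)
  transitivity (hom_comp f (hom_comp (hom_comp f' (hom_comp c g)) g')).
    by rewrite -!hom_compA gg' hom_comp1r hom_compA ff' hom_comp1l.
  by rewrite (hom0 (hom_comp f' _)) hom_comp0l hom_comp0r.
apply/negPn/negP => /= /norP[/negbTE tF /norP[/negbTE uF ba]]; subst t u.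
have [m am] : exists m, a = (b + m.+1)%N by exists (a - b).-1; lia.
subst a; apply: (@Ext_simple_nonzero b m); first lia.
exact: Ext_zero_isoD isoN (Ext_zero_isoE isoM (ext0 _ _)).
Qed.

End Thin.

Theorem theorem1p1 (k : closedFieldType) (n : nat) (hn : (1 <= n)%N) :
  exists F : ('I_n -> 'I_n) -> n.-tuple (set (rep k n)),
    set_bij [set f : 'I_n -> 'I_n | f \o f = f]%classic
            (@complete_exceptional_sequences k n) F.
Proof.
pose T (f : 'I_n -> 'I_n) : n.-tuple (rep k n) :=
  [tuple thin k n (letter f j).1 (letter f j).2 | j < n].
have idem (f : 'I_n -> 'I_n) : f \o f = f -> forall i, f (f i) = f i.
  by move=> ff i; exact: (congr1 (fun g => g i) ff).
exists (fun f => map_tuple (@isoclass k n) (T f)); split.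
- move=> f /= /idem ff; exists (T f) => //; split=> [i|i j ij].
    by rewrite tnth_mktuple; apply: thin_exceptional; exact: letter_range.
  rewrite !tnth_mktuple; apply: compatible_exceptional_pair.
  + exact: letter_range.
  + exact: letter_range.
  + exact: letter_compatible.
- move=> f g; rewrite !inE /= => /idem ff /idem gg fg.
  apply: letter_inj => // j.
  have := congr1 (fun t => tnth t j) fg.
  rewrite !tnth_map !tnth_ord_tuple => /isoclassP iso.
  have := thin_isomorphic_inj (letter_range ff j) (letter_range gg j) iso.
  by case: (letter f j) (letter g j) => [? ?] [? ?].
- move=> _ [M [excM pairM] <-].
  have /choice[w wP] (j : 'I_n) : exists x : bool * nat,
      (x.2 + x.1 < n)%N /\ isomorphic (tnth M j) (thin k n x.1 x.2).
    have [t [a ta]] := brick_thin (exceptional_brick (excM j)).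
    by exists (t, a).
  have wcompat (i j : 'I_n) : (i < j)%N -> compatible (w i) (w j).
    move=> ij; have [wi isoi] := wP i; have [wj isoj] := wP j.
    exact: exceptional_pair_compatible wi wj isoi isoj (pairM i j ij).
  have [f [ff fw]] := letter_onto wcompat (fun j => (wP j).1).
  exists f; first by apply/funext => i /=.
  apply: eq_from_tnth => j; rewrite !tnth_map tnth_ord_tuple fw.
  by apply/esym/isoclassP; have [] := wP j.
Qed.
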